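(* Let $d_1>d_2>1$ and $f\ge0$ be integers, let $n=d_1+d_2+f$, and let $\beta\in\mathcal S_n$ have cycle structure $d_1\cdot d_2\cdot1^f$ (one $d_1$-cycle, one $d_2$-cycle, $f$ fixed points). Then $(\varepsilon,\beta,\beta;(12))\in\mathrm{Par}(n)$ if and only if $d_1/d_2$ is an odd integer and $f=0$.
   Context: A Latin square of order $n$ is an $n\times n$ array with rows, columns and symbols indexed by $[n]$, each symbol occurring once in each row and each column, with triple set $O(L)$. Permutations act on the right; $\varepsilon$ is the identity. A paratopism $(\alpha,\beta,\gamma;(12))$ maps $L$ to $L^\sigma$ with triple set $\{(y\beta,x\alpha,z\gamma):(x,y,z)\in O(L)\}$; it is an autoparatopism of $L$ if $L^\sigma=L$. $\mathrm{Par}(n)$ is the set of paratopisms that are autoparatopisms of at least one Latin square of order $n$. *)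

(* Defs.v *)
From mathcomp Require Import all_boot all_fingroup.
Set Implicit Arguments. Unset Strict Implicit. Unset Printing Implicit Defensive.

Definition latin_square n (L : {ffun 'I_n * 'I_n -> 'I_n}) : Prop :=
  (forall x, injective (fun y => L (x, y))) /\
  (forall y, injective (fun x => L (x, y))).

Definition triples n (L : {ffun 'I_n * 'I_n -> 'I_n}) : {set 'I_n * 'I_n * 'I_n} :=
  [set t : 'I_n * 'I_n * 'I_n | L (t.1.1, t.1.2) == t.2].

(* Image of a triple set under the paratopism (a, b, c; (12)):
   (x,y,z) |-> (y b, x a, z c), permutations acting on the right
   (so "x a" is the MathComp application a x). *)
Definition par12_image n (a b c : 'S_n) (T : {set 'I_n * 'I_n * 'I_n}) :
  {set 'I_n * 'I_n * 'I_n} :=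
  [set (b t.1.2, a t.1.1, c t.2) | t in T].

Definition autopar12 n (a b c : 'S_n) (L : {ffun 'I_n * 'I_n -> 'I_n}) : Prop :=
  par12_image a b c (triples L) = triples L.

Definition in_Par12 n (a b c : 'S_n) : Prop :=
  exists L : {ffun 'I_n * 'I_n -> 'I_n}, latin_square L /\ autopar12 a b c L.

Definition cycle_lengths n (s : 'S_n) : seq nat :=
  map (fun X : {set 'I_n} => #|X|) (enum (porbits s)).

(* Main.v *)
(* The autoparatopism condition reads L(by, x) = b L(x, y), whence
   L(b^m x, b^m y) = b^(2m) L(x, y). If two of x, y, L(x, y) are fixed by b^m,
   b^m and b^(2m) respectively, so is the third. Let A be the long cycle and
   let x be in A and y outside A. Then L(x, y) is in A; for y in the short cycle,
   m = d1 gives d2 | d1, and m = d1/2 shows that d1/d2 is not even. A fixed point u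
   forces d1 = 2j+1, and then every symbol outside A occurs at some cell
   (b^(j+1) y, y) with y in A; the symbols of these cells are related by powers
   of b, so u would be in the short cycle. Conversely, for d1 = (2m+1) d2, the
   addition table modulo d1 is prolonged along its d2 middle diagonals by the
   addition table modulo d2. *)
Require Import Defs.
From mathcomp Require Import all_boot all_fingroup all_order all_algebra.
From mathcomp Require Import zify ring.
Set Implicit Arguments. Unset Strict Implicit. Unset Printing Implicit Defensive.

(** * Involutions, powers of a permutation and orbit lengths *)

(** Removing a non-fixed point together with its image keeps the cardinality odd, so induction
    applies. *)
Lemma odd_involution_fixpoint (T : finType) (A : {set T}) (p : T -> T) :
  {in A, forall x, p x \in A} -> {in A, forall x, p (p x) = x} -> odd #|A| ->
  exists2 x, x \in A & p x = x.
Proof.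
have [c] := ubnP #|A|; elim: c A => // c IH A leAc pA ppA oddA.
have [x Ax] : exists x, x \in A by apply/card_gt0P; apply: odd_gt0.
have [px | px] := eqVneq (p x) x; first by exists x.
pose B := A :\ x :\ p x.
have pxAx : p x \in A :\ x by rewrite !inE px pA.
have cardA : #|A| = #|B|.+2 by rewrite (cardsD1 x A) Ax (cardsD1 (p x)) pxAx.
have BA y : y \in B -> y \in A by rewrite !inE => /and3P[].
case: (IH B) => [|y By|y By||y By]; first by rewrite -ltnS -cardA ltnW.
- move: (By); rewrite !inE => /and3P[ypx yx Ay]; rewrite pA // andbT.
  apply/andP; split; [apply: contra yx | apply: contra ypx] => /eqP pE.
    by rewrite -(ppA y) // pE ppA.
  by rewrite -(ppA y) // pE.
- exact: ppA (BA _ By).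
- by move: oddA; rewrite cardA /= negbK.
- by move=> pyy; exists y => //; apply: BA.
Qed.

Lemma perm_expg_fixE (T : finType) (s : {perm T}) (x : T) (m : nat) :
  ((s ^+ m)%g x == x) = (#|porbit s x| %| m).
Proof.
set o := #|porbit s x|.
have o_gt0 : 0 < o by rewrite lt0n card_porbit_neq0.
have fix_mul q : (s ^+ (q * o))%g x = x.
  elim: q => [|q IHq]; first by rewrite mul0n expg0 perm1.
  by rewrite mulSn expgD permM [(s ^+ o)%g x]permX /o iter_porbit.
rewrite {1}(divn_eq m o) expgD permM fix_mul /dvdn permX.
rewrite -(nth_traject s (ltn_pmod m o_gt0)) -[X in _ == X](nth_traject s o_gt0).
by rewrite nth_uniq ?size_traject ?ltn_pmod ?uniq_traject_porbit.
Qed.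

Lemma mem_cycle_lengths n (s : 'S_n) (x : 'I_n) :
  #|porbit s x| \in cycle_lengths s.
Proof. by apply: map_f; rewrite mem_enum; apply: imset_f. Qed.

Lemma cycle_lengthsP n (s : 'S_n) (c : nat) :
  c \in cycle_lengths s -> exists x, #|porbit s x| = c.
Proof.
by case/mapP=> X; rewrite mem_enum => /imsetP[x _ ->] ->; exists x.
Qed.

Lemma count_cycle_lengths_le1 n (s : 'S_n) (x y : 'I_n) :
  count_mem #|porbit s x| (cycle_lengths s) <= 1 ->
  #|porbit s y| = #|porbit s x| -> y \in porbit s x.
Proof.
move=> le1 sizes; rewrite -eq_porbit_mem; apply/eqP.
move: le1; rewrite count_map -size_filter => le1.
set c := #|porbit s x| in le1 sizes *.
have memc z : #|porbit s z| = c ->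
  porbit s z \in [seq X : {set _} <- enum (porbits s) | #|X| == c].
  by move=> zc; rewrite mem_filter mem_enum /= zc eqxx imset_f.
have := memc x erefl; have := memc y sizes; move: le1.
by case: filter => [|X []] //= _; rewrite !inE => /eqP-> /eqP->.
Qed.

(** * The autoparatopism condition as a functional equation *)

Lemma autopar12_1P n (s : 'S_n) (L : {ffun 'I_n * 'I_n -> 'I_n}) :
  autopar12 1 s s L <-> forall x y, L (s y, x) = s (L (x, y)).
Proof.
split=> [autL x y | LE].
  have : (s y, (1%g : 'S_n) x, s (L (x, y))) \in triples L.
    by rewrite -autL; apply/imsetP; exists (x, y, L (x, y)); rewrite ?inE.
  by rewrite inE /= perm1 => /eqP.
(* The map on triples is injective, so one inclusion suffices. *)
apply/eqP; rewrite eqEcard; apply/andP; split.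
  apply/subsetP=> _ /imsetP[[[x y] z] zL ->]; move: zL; rewrite inE /= => /eqP <-.
  by rewrite inE /= perm1 LE.
rewrite card_imset // => -[[x y] z] [[x' y'] z'] /= [].
by rewrite !perm1 => /perm_inj-> -> /perm_inj->.
Qed.

(** Two applications of the equation restore the order of the arguments, so one step of [s] on both
    arguments is two steps on the symbol. *)
Lemma commuting_mul_expg n (s : 'S_n) (L : {ffun 'I_n * 'I_n -> 'I_n}) :
  (forall x y, L (s y, x) = s (L (x, y))) ->
  forall m x y, L ((s ^+ m)%g x, (s ^+ m)%g y) = (s ^+ (2 * m))%g (L (x, y)).
Proof.
move=> LE; elim=> [|m IH] x y; first by rewrite !expg0 !perm1.
by rewrite mulnS addnC expgD !expgSr expg0 mul1g !permM !LE IH.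
Qed.

Lemma commuting_mul_dvd n (s : 'S_n) (L : {ffun 'I_n * 'I_n -> 'I_n}) :
  latin_square L -> (forall x y, L (s y, x) = s (L (x, y))) ->
  forall m x y, #|porbit s (L (x, y))| %| 2 * m ->
  (#|porbit s x| %| m) = (#|porbit s y| %| m).
Proof.
move=> [rowL colL] LE m x y; rewrite -!perm_expg_fixE => /eqP fixz.
have := commuting_mul_expg LE m x y; rewrite fixz => Lm.
apply/eqP/eqP => fixm; rewrite fixm in Lm.
- exact: rowL Lm.
- exact: colL Lm.
Qed.

(* The (2j+1)-st power of the paratopism swaps the cell (x, y) with
   (s^(j+1) y, s^j x) and fixes the symbol z, so sending the row x to s^(j+1) y,
   where L (x, y) = z, is an involution of the odd orbit of a. *)
Lemma odd_orbit_diagonal n (s : 'S_n) (L : {ffun 'I_n * 'I_n -> 'I_n})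
    (a z : 'I_n) (j : nat) :
  latin_square L -> (forall x y, L (s y, x) = s (L (x, y))) ->
  #|porbit s a| = j.*2.+1 -> #|porbit s z| %| j.*2.+1 ->
  {in porbit s a, forall x y, L (x, y) = z -> y \in porbit s a} ->
  exists2 y, y \in porbit s a & L ((s ^+ j.+1)%g y, y) = z.
Proof.
move=> [rowL colL] LE oa oz za.
pose col x := invF (rowL x) z.
have colE x : L (x, col x) = z by apply: (f_invF (rowL x)).
have colA x : x \in porbit s a -> col x \in porbit s a.
  by move=> Ax; apply: za Ax _ (colE x).
have expA m x : x \in porbit s a -> (s ^+ m)%g x \in porbit s a.
  by rewrite -!eq_porbit_mem porbit_perm.
pose p x := (s ^+ j.+1)%g (col x).
have colp x : col (p x) = (s ^+ j)%g x.
  apply: (rowL (p x)); rewrite colE /p expgSr permM LE commuting_mul_expg //.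
  rewrite colE -permM -expgSr mul2n; apply/esym/eqP.
  by rewrite perm_expg_fixE.
have [|x Ax||x Ax px] := @odd_involution_fixpoint _ (porbit s a) p.
- by move=> x Ax; apply/expA/colA.
- rewrite /p colp -permM -expgD; apply/eqP; rewrite perm_expg_fixE.
  move: Ax; rewrite -eq_porbit_mem => /eqP->; rewrite oa.
  by rewrite addnS addnn.
- by rewrite oa /= odd_double.
- by exists (col x); [apply: colA | rewrite -[X in L (X, _)]/(p x) px].
Qed.

(** * Necessary conditions on the cycle lengths *)

Lemma in_Par12_necessary n (s : 'S_n) (d1 d2 : nat) (a b : 'I_n) :
  d2 < d1 -> 1 < d2 -> in_Par12 1 s s ->
  #|porbit s a| = d1 -> #|porbit s b| = d2 ->
  (forall x, x \in porbit s a \/ #|porbit s x| %| d2) ->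
  [/\ d2 %| d1, odd (d1 %/ d2) & forall u, #|porbit s u| != 1].
Proof.
move=> d21 d2gt1 [L [latL /autopar12_1P LE]] oa ob split_a.
have ndvd : ~~ (d1 %| d2) by rewrite gtnNdvd // ltnW.
have oA x : x \in porbit s a -> #|porbit s x| = d1.
  by rewrite -eq_porbit_mem => /eqP->.
have d1half m : m.*2 = d1 -> ~~ (d1 %| m) by move=> md; rewrite gtnNdvd; lia.
have dvdL := commuting_mul_dvd latL LE.
(* Take m = [d2]: a symbol whose length divides [d2] would let [s^d2] fix [x] along with [y], but
   [d1] does not divide [d2]. *)
have offA x y : x \in porbit s a -> #|porbit s y| %| d2 ->
  L (x, y) \in porbit s a.
  move=> Ax oy; case: (split_a (L (x, y))) => // oz.
  by have := dvdL d2 x y (dvdn_mull _ oz); rewrite oy oA // (negPf ndvd).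
have d2dvd : d2 %| d1.
  have := dvdL d1 a b; rewrite oa ob oA ?offA ?ob ?porbit_id //.
  by rewrite dvdn_mull // dvdnn => /(_ isT) <-.
split=> //; first case: (boolP (odd _)) => // /negPf even_q.
  have d1E : d1 = ((d1 %/ d2)./2 * d2).*2.
    by rewrite doubleMl even_halfK ?even_q ?divnK.
  have := dvdL ((d1 %/ d2)./2 * d2) a b; rewrite oa ob oA ?offA ?ob ?porbit_id //.
  by rewrite mul2n -d1E dvdnn (dvdn_mull _ (dvdnn d2)) (negPf (d1half _ (esym d1E))) => /(_ isT).
move=> u; apply/eqP=> ou.
have odd1 : odd d1.
  case: (boolP (odd d1)) => // even1.
  have d1E := even_halfK even1.
  have := dvdL d1./2 a u; rewrite oa ou oA ?offA ?ou ?porbit_id ?dvd1n //.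
  by rewrite mul2n d1E dvdnn (negPf (d1half _ d1E)) => /(_ isT).
have d1E : d1 = d1./2.*2.+1 by rewrite -[LHS]odd_double_half odd1.
have diag z : #|porbit s z| %| d2 ->
  exists2 y, y \in porbit s a & L ((s ^+ (d1./2).+1)%g y, y) = z.
  move=> oz; apply: odd_orbit_diagonal => //.
  - by rewrite oa -d1E.
  - by rewrite -d1E (dvdn_trans oz).
  - move=> x Ax y Lz; case: (split_a y) => // oy.
    have /oA := offA x y Ax oy.
    by rewrite Lz => ozd; rewrite ozd (negPf ndvd) in oz.
have [|y Ay Ly] := diag u; first by rewrite ou dvd1n.
have [|y' Ay' Ly'] := diag b; first by rewrite ob.
(* As y' = s^i y, the i-th power carries the cell of [u] to that of [b], so b = s^(2i) u lies in an
   orbit of length 1. *)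
have /porbitP[i y'E] : y' \in porbit s y.
  by move: Ay Ay'; rewrite -!eq_porbit_mem => /eqP->.
have := commuting_mul_expg LE i ((s ^+ (d1./2).+1)%g y) y.
rewrite Ly -y'E -permM -expgD addnC expgD permM -y'E Ly' => bE.
by move: ob; rewrite bE porbit_perm ou => d2E; rewrite -d2E in d2gt1.
Qed.

(** * The prolonged addition table, computed on integers *)

Import Order.TTheory GRing.Theory Num.Theory.
Local Open Scope ring_scope.

(* inl and inr stand for residues modulo d1 and d2: the points of the long and
   of the short cycle. *)
Definition congr_sum (d1 d2 : int) (u v : int + int) : bool :=
  match u, v with
  | inl x, inl y => (d1 %| x - y)%Z
  | inr x, inr y => (d2 %| x - y)%Z
  | _, _ => false
  end.

Definition succ_sum (u : int + int) : int + int :=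
  match u with inl x => inl (x + 1) | inr x => inr (x + 1) end.

(* Modulo (2m+1)d the residues split into 2m+1 blocks of d consecutive ones;
   the middle block is the one stable under x |-> -1-x. *)
Definition mid_block (d m x : int) : bool := (2 * m + 1 %| (x %/ d)%Z - m)%Z.

(* The addition table modulo (2m+1)d whose middle diagonals y - x are moved to
   the columns of the short cycle, and filled with symbols of the short cycle. *)
Definition prolonged_add (d m : int) (u v : int + int) : int + int :=
  match u, v with
  | inl x, inl y => if mid_block d m (y - x) then inr (x + y) else inl (x + y)
  | inl x, inr y => inl (2 * x + m * d + ((y - x) %% d)%Z)
  | inr y, inl x => inl (2 * x + m * d + ((y - 1 - x) %% d)%Z + 1)
  | inr x, inr y => inr (x + y)
  end.

Lemma eq_modz_dvd (d x y : int) : (d %| x - y)%Z = ((x %% d)%Z == (y %% d)%Z).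
Proof. by rewrite -eqz_mod_dvd. Qed.

Lemma mid_block_congr (d m x y : int) :
  0 < d -> ((2 * m + 1) * d %| x - y)%Z -> mid_block d m x = mid_block d m y.
Proof.
move=> d_gt0 /dvdzP[t /(canRL (subrK _)) ->].
rewrite /mid_block mulrA divzMDl ?gt_eqF //.
by rewrite -addrA rpredDl // dvdz_mull.
Qed.

(** Block q goes to block -q-1, and -m-1 = m modulo 2m+1. This reflection arises because the
    paratopism takes the cell (x, y) to (y+1, x). *)
Lemma mid_block_opp (d m x : int) :
  0 < d -> mid_block d m (- 1 - x) = mid_block d m x.
Proof.
move=> d_gt0; rewrite /mid_block.
set q := (x %/ d)%Z; set r := (x %% d)%Z.
have xE : x = q * d + r by apply: divz_eq.
have r_ge0 : 0 <= r by apply: modz_ge0; rewrite gt_eqF.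
have r_lt : r < d by apply: ltz_pmod.
have -> : divz (- 1 - x) d = - q - 1.
  have -> : -1 - x = (- q - 1) * d + (d - 1 - r) by rewrite xE; ring.
  rewrite divzMDl ?gt_eqF // divz_small ?addr0 //; lia.
have -> : - q - 1 - m = - (2 * m + 1) - (q - m) by ring.
by rewrite rpredBl // rpredN.
Qed.

(** A block has d consecutive residues, so within the middle one the residue modulo d determines the
    residue modulo (2m+1)d. Hence the short symbols on the middle diagonals do not repeat in a
    row. *)
Lemma mid_block_dvd (d m x y : int) : 0 < d ->
  mid_block d m x -> mid_block d m y -> (d %| x - y)%Z ->
  ((2 * m + 1) * d %| x - y)%Z.
Proof.
move=> d_gt0 /dvdzP[t tE] /dvdzP[t' t'E]; rewrite eq_modz_dvd => /eqP rE.
apply/dvdzP; exists (t - t').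
rewrite (divz_eq x d) (divz_eq y d) rE.
by rewrite (canRL (subrK _) tE) (canRL (subrK _) t'E); ring.
Qed.

Lemma mid_block_offset (d m x e : int) : 0 <= e < d ->
  ((2 * m + 1) * d %| x - (m * d + e))%Z -> mid_block d m x.
Proof.
move=> /andP[e_ge0 e_lt]; have d_gt0 := le_lt_trans e_ge0 e_lt.
move=> /(mid_block_congr d_gt0) ->; rewrite /mid_block divzMDl ?gt_eqF //.
rewrite divz_small ?addr0 ?subrr ?dvdz0 //; lia.
Qed.

(** The table descends to residues: long and short arguments are only mixed modulo d, which divides
    (2m+1)d. *)
Lemma prolonged_add_congr (d m : int) (u u' v v' : int + int) : 0 < d ->
  congr_sum ((2 * m + 1) * d) d u u' -> congr_sum ((2 * m + 1) * d) d v v' ->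
  congr_sum ((2 * m + 1) * d) d (prolonged_add d m u v) (prolonged_add d m u' v').
Proof.
move=> d_gt0; set k := (2 * m + 1) * d.
have dk z : (k %| z)%Z -> (d %| z)%Z by apply: dvdz_trans; rewrite dvdz_mull.
case: u u' v v' => [x|x] [x'|x'] [y|y] [y'|y'] //= xx yy.
- have -> : mid_block d m (y - x) = mid_block d m (y' - x').
    apply: mid_block_congr => //.
    have -> : y - x - (y' - x') = (y - y') - (x - x') by ring.
    exact: rpredB.
  have sumE : x + y - (x' + y') = (x - x') + (y - y') by ring.
  by case: ifP => _ /=; rewrite sumE rpredD // dk.
- have /eqP -> : modz (y - x) d == modz (y' - x') d.
    rewrite -eq_modz_dvd.
    have -> : y - x - (y' - x') = (y - y') - (x - x') by ring.
    by rewrite rpredB // dk.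
  set e := modz _ _.
  have -> : 2 * x + m * d + e - (2 * x' + m * d + e) = 2 * (x - x') by ring.
  by rewrite dvdz_mull.
- have /eqP -> : modz (x - 1 - y) d == modz (x' - 1 - y') d.
    rewrite -eq_modz_dvd.
    have -> : x - 1 - y - (x' - 1 - y') = (x - x') - (y - y') by ring.
    by rewrite rpredB // dk.
  set e := modz _ _.
  have -> : 2 * y + m * d + e + 1 - (2 * y' + m * d + e + 1) = 2 * (y - y') by ring.
  by rewrite dvdz_mull.
- have -> : x + y - (x' + y') = (x - x') + (y - y') by ring.
  exact: rpredD.
Qed.

(** The clause for short rows is the clause for short columns read through this equation; on long
    rows and columns it rests on [mid_block_opp]. *)
Lemma prolonged_add_succ (d m : int) (u v : int + int) : 0 < d ->
  prolonged_add d m (succ_sum v) u = succ_sum (prolonged_add d m u v).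
Proof.
move=> d_gt0; case: u v => [x|x] [y|y] /=.
- have -> : x - (y + 1) = -1 - (y - x) by ring.
  by rewrite mid_block_opp //; case: ifP => _ /=; congr (_ _); ring.
- by congr (inl _); have -> : y + 1 - 1 - x = y - x by ring.
- congr (inl _); have -> : x - (y + 1) = x - 1 - y by ring.
  by ring.
- by congr (inr _); ring.
Qed.

(** In a long row x, a short column holds 2x + md + e = x + (x + md + e) with 0 <= e < d, the symbol
    displaced from the middle cell in column x + md + e; [no_clash] says that it occurs in no other
    long column. *)
Lemma prolonged_add_inj (d m : int) (u v w : int + int) : 0 < d ->
  congr_sum ((2 * m + 1) * d) d (prolonged_add d m u v) (prolonged_add d m u w) ->
  congr_sum ((2 * m + 1) * d) d v w.
Proof.
move=> d_gt0; set k := (2 * m + 1) * d.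
have dk z : (k %| z)%Z -> (d %| z)%Z by apply: dvdz_trans; rewrite dvdz_mull.
have modP z : 0 <= modz z d < d by rewrite modz_ge0 ?ltz_pmod ?gt_eqF.
have modd z : (d %| modz z d - z)%Z by rewrite eq_modz_dvd modz_mod.
have symd z t : (k %| z - t)%Z -> (k %| t - z)%Z by rewrite -opprB rpredN.
have no_clash x y z : (k %| x + y - (2 * x + m * d + modz (z - x) d))%Z ->
    mid_block d m (y - x).
  set e := modz _ _.
  have -> : x + y - (2 * x + m * d + e) = y - x - (m * d + e) by ring.
  by apply: mid_block_offset; apply: modP.
case: u v w => [x|x] [y|y] [z|z] //=.
- case: ifPn => midy; case: ifPn => midz //=.
  + have -> : x + y - (x + z) = (y - x) - (z - x) by ring.
    by move/(mid_block_dvd d_gt0 midy midz); rewrite opprB addrA subrK.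
  + by have -> : x + y - (x + z) = y - z by ring.
- by case: ifPn => //= midy /no_clash; rewrite (negPf midy).
- by case: ifPn => //= midz /symd /no_clash; rewrite (negPf midz).
- have -> (e e' : int) : 2 * x + m * d + e - (2 * x + m * d + e') = e - e' by ring.
  move/dk; rewrite eq_modz_dvd !modz_mod -eq_modz_dvd.
  by have -> : y - x - (z - x) = y - z by ring.
(* In a short row, the symbol in column y is x + y + md modulo d, so y and z agree modulo d and the
   offsets e, e' coincide. *)
- set e := modz (x - 1 - y) d; set e' := modz (x - 1 - z) d => kdvd.
  have dyz : (d %| y - z)%Z.
    have -> : y - z = (2 * y + m * d + e + 1 - (2 * z + m * d + e' + 1))
      - (e - (x - 1 - y)) + (e' - (x - 1 - z)) by ring.
    by apply: rpredD; [apply: rpredB; [apply: dk | apply: modd] | apply: modd].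
  have ee' : e = e'.
    apply/eqP; rewrite -eq_modz_dvd.
    have -> : x - 1 - y - (x - 1 - z) = - (y - z) by ring.
    by rewrite rpredN.
  move: kdvd dyz; rewrite ee'.
  have -> : 2 * y + m * d + e' + 1 - (2 * z + m * d + e' + 1) = 2 * (y - z) by ring.
  move=> kdvd /dvdzP[t tE]; move: kdvd; rewrite tE mulrA /k !dvdz_mul2r ?gt_eqF //.
  (* This inverts 2 modulo the odd number 2m+1. *)
  move=> dvd2t; have -> : t = t * (2 * m + 1) - m * (2 * t) by ring.
  by apply: rpredB; apply: dvdz_mull.
- by have -> : x + y - (x + z) = y - z by ring.
Qed.

(** * Transfer from integers to the two orbits *)

(** Integer powers of [s] along the orbit of [x], which identify it with the residues modulo its
    length. *)
Definition expz_perm (T : finType) (s : {perm T}) (x : T) (i : int) : T :=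
  (s ^+ absz (modz i #|porbit s x|))%g x.

Lemma expz_perm_eq (T : finType) (s : {perm T}) (x : T) (i j : int) :
  (expz_perm s x i == expz_perm s x j) = (#|porbit s x|%:Z %| i - j)%Z.
Proof.
rewrite eq_modz_dvd /expz_perm; set o := #|porbit s x|.
have o_neq0 : o%:Z != 0 by rewrite eqz_nat card_porbit_neq0.
have modP z : (absz (modz z o) < o)%N.
  by rewrite -ltz_nat gez0_abs ?modz_ge0 // ltz_pmod // ltz_nat lt0n -eqz_nat.
rewrite !permX -!(nth_traject s (modP _)).
rewrite nth_uniq ?size_traject ?uniq_traject_porbit //.
by rewrite -eqz_nat !gez0_abs ?modz_ge0.
Qed.

Lemma expz_perm_nat (T : finType) (s : {perm T}) (x : T) (i : nat) :
  expz_perm s x i = (s ^+ i)%g x.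
Proof.
rewrite /expz_perm modz_nat absz_nat [in RHS](divn_eq i #|porbit s x|).
rewrite expgD permM; set q := (_ * _)%N.
have /eqP -> : (s ^+ q)%g x == x by rewrite perm_expg_fixE dvdn_mull.
by [].
Qed.

Lemma expz_perm_succ (T : finType) (s : {perm T}) (x : T) (i : int) :
  expz_perm s x (i + 1) = s (expz_perm s x i).
Proof.
have o_neq0 : #|porbit s x|%:Z != 0 by rewrite eqz_nat card_porbit_neq0.
rewrite -permM -expgSr -expz_perm_nat; apply/eqP; rewrite expz_perm_eq.
by rewrite -addn1 PoszD gez0_abs ?modz_ge0 // eq_modz_dvd modzDml.
Qed.

Lemma in_Par12_sufficient n (s : 'S_n) (d m : nat) (a b : 'I_n) :
  #|porbit s a| = (m.*2.+1 * d)%N -> #|porbit s b| = d ->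
  b \notin porbit s a -> (forall x, x \in porbit s a \/ x \in porbit s b) ->
  in_Par12 1 s s.
Proof.
move=> oa ob ba cover.
have d_gt0 : 0 < d%:Z by rewrite ltz_nat -ob lt0n card_porbit_neq0.
pose enc (u : int + int) := match u with
  | inl i => expz_perm s a i
  | inr i => expz_perm s b i
  end.
pose congr := congr_sum ((2 * m%:Z + 1) * d) d.
have daE : #|porbit s a|%:Z = (2 * m%:Z + 1) * d.
  by rewrite oa; lia.
have enc_clash i j : ((s ^+ i)%g a == (s ^+ j)%g b) = false.
  apply/negP=> /eqP ijE; case/negP: ba.
  by rewrite -eq_porbit_mem -(porbit_perm s i a) ijE porbit_perm.
have encP u v : (enc u == enc v) = congr u v.
  case: u v => [i|i] [j|j] /=.
  - by rewrite expz_perm_eq daE.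
  - exact: enc_clash.
  - by rewrite eq_sym enc_clash.
  - by rewrite expz_perm_eq ob.
have enc_succ u : enc (succ_sum u) = s (enc u).
  by case: u => i; apply: expz_perm_succ.
have enc_surj x : exists u, enc u == x.
  case: (cover x) => /porbitP[i ->]; [exists (inl i%:Z) | exists (inr i%:Z)];
    by rewrite /enc expz_perm_nat.
(* Any representative will do, since [op] respects [congr]. *)
pose dec x := xchoose (enc_surj x).
have decK x : enc (dec x) = x by apply/eqP/(xchooseP (enc_surj x)).
pose op := prolonged_add d m.
pose L : {ffun 'I_n * 'I_n -> 'I_n} := [ffun t => enc (op (dec t.1) (dec t.2))].
have LE u v : L (enc u, enc v) = enc (op u v).
  apply/eqP; rewrite ffunE encP; apply: prolonged_add_congr => //.
  - by rewrite -/(congr _ _) -encP decK.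
  - by rewrite -/(congr _ _) -encP decK.
have Lsucc x y : L (s y, x) = s (L (x, y)).
  rewrite -(decK x) -(decK y) -enc_succ !LE -enc_succ.
  by rewrite /op prolonged_add_succ.
have rowL x : injective (fun y => L (x, y)).
  move=> y z /eqP; rewrite -(decK x) -(decK y) -(decK z) !LE !encP => yz.
  by apply/eqP; rewrite encP; apply: prolonged_add_inj yz.
exists L; split; last exact/autopar12_1P.
(* By [Lsucc] the column of y is, up to [s], the row of y, so columns inherit injectivity from
   rows. *)
split=> // y x z; rewrite -{1}(permKV s x) -{1}(permKV s z) !Lsucc.
by move/perm_inj/rowL/perm_inj.
Qed.

Local Close Scope ring_scope.

(** * Reading the two orbits off the cycle structure *)

Theorem theorem4p15 (d1 d2 f : nat) (beta : 'S_(d1 + d2 + f)) :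
  d2 < d1 -> 1 < d2 ->
  perm_eq (cycle_lengths beta) (d1 :: d2 :: nseq f 1) ->
  (in_Par12 1 beta beta <-> ((d2 %| d1) && odd (d1 %/ d2) /\ f = 0)).
Proof.
move: (d1 + d2 + f) beta => n beta d21 d2gt1 lens.
have memE c : (c \in cycle_lengths beta) = (c \in d1 :: d2 :: nseq f 1).
  exact: perm_mem.
(* Since [d1] and [d2] differ and the other lengths are 1, a length above 1 determines its orbit. *)
have once c : 1 < c -> count_mem c (cycle_lengths beta) <= 1.
  move=> c_gt1; have /seq.permP-> := lens; rewrite /= count_nseq /=.
  by lia.
have [a oa] : exists a, #|porbit beta a| = d1.
  by apply: cycle_lengthsP; rewrite memE !inE eqxx.
have [b ob] : exists b, #|porbit beta b| = d2.
  by apply: cycle_lengthsP; rewrite memE !inE eqxx orbT.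
have inA x : #|porbit beta x| = d1 -> x \in porbit beta a.
  by rewrite -oa; apply: count_cycle_lengths_le1; rewrite oa once // (ltn_trans d2gt1).
have inB x : #|porbit beta x| = d2 -> x \in porbit beta b.
  by rewrite -ob; apply: count_cycle_lengths_le1; rewrite ob once.
have lenP x : [\/ #|porbit beta x| = d1, #|porbit beta x| = d2 |
                  #|porbit beta x| = 1 /\ 0 < f].
  have := mem_cycle_lengths beta x; rewrite memE !inE mem_nseq.
  by case/or3P=> [/eqP-> | /eqP-> | /andP[? /eqP->]]; constructor.
split=> [par | [/andP[d2dvd odd_q] f0]].
  have [|d2dvd odd_q no_fix] := in_Par12_necessary d21 d2gt1 par oa ob.
    move=> x; case: (lenP x) => [/inA | -> | [-> _]]; [by left | by right |].
    by right; rewrite dvd1n.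
  rewrite d2dvd odd_q; split=> //; apply/eqP; rewrite -leqn0 leqNgt.
  apply/negP=> f_gt0; have [u ou] : exists u, #|porbit beta u| = 1.
    by apply: cycle_lengthsP; rewrite memE !inE mem_nseq f_gt0 eqxx !orbT.
  by have := no_fix u; rewrite ou.
(* The odd quotient is 2m+1, with m its half rounded down. *)
apply: (@in_Par12_sufficient _ _ d2 (d1 %/ d2)./2 a b) => //.
- by rewrite oa -[d1 in LHS](divnK d2dvd) -[d1 %/ d2 in LHS]odd_double_half odd_q.
- apply/negP; rewrite -eq_porbit_mem => /eqP ba.
  by move: d21; rewrite -oa -ba ob ltnn.
- move=> x; case: (lenP x) => [/inA | /inB | [_]]; [by left | by right |].
  by rewrite f0.
Qed.
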